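(* Let $a = (a_1,\ldots,a_n)^\top \in (\mathbb{Z}\setminus\{0\})^n$ be a vector that contains both positive and negative components, and let $b \in \mathbb{Z}$. If the knapsack feasibility problem $a^\top x = b$, $x \in \mathbb{Z}_{\ge 0}^n$, has a solution, then there is a solution $x$ satisfying $$\|x\|_0 \le 2 + \min\left\{ \omega\left( \frac{|a_i|}{\gcd(a)} \right) : i \in \{1,\ldots,n\} \right\}.$$ Moreover, under these assumptions, for given $a$ and $b$, such a sparse solution $x$ can be computed in polynomial time.
   Context: For $x\in\mathbb{R}^n$, $\|x\|_0 := |\{i : x_i \neq 0\}|$. $\gcd(a)$ is the (positive) greatest common divisor of $a_1,\ldots,a_n$. For a positive integer $z$, $\omega(z)$ is the number of distinct prime factors of $z$ (so $\omega(1)=0$). Polynomial time means polynomial in the binary encoding size of the input. *)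

(* Defs.v *)
From mathcomp Require Import all_boot all_order all_algebra.

Set Implicit Arguments.
Unset Strict Implicit.
Unset Printing Implicit Defensive.

Import Order.TTheory GRing.Theory Num.Theory.
Local Open Scope ring_scope.

Definition norm0 n (x : 'cV[int]_n) : nat := #|[set i | x i 0 != 0]|.

Definition gcdv n (a : 'cV[int]_n) : nat := \big[gcdn/0%N]_i `|a i ord0|%N.

Definition omega (z : nat) : nat := size (primes z).

(* [minn] has no neutral element on [nat]; starting the iteration from the
   maximum yields the minimum as soon as [0 < n], see [minI_le] and
   [minI_attained]. *)
Definition minI n (f : 'I_n -> nat) : nat :=
  \big[minn/(\max_(i < n) f i)%N]_(i < n) f i.

Lemma minI_le n (f : 'I_n -> nat) (i : 'I_n) : (minI f <= f i)%N.
Proof.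
rewrite /minI; move: (X in bigop X) => z.
elim: (index_enum _) (mem_index_enum i) => //= j s IH.
rewrite inE big_cons => /orP[/eqP<-|/IH]; first exact: geq_minl.
by move=> le_i; apply: leq_trans le_i; apply: geq_minr.
Qed.

Lemma minI_attained n (f : 'I_n -> nat) : (0 < n)%N -> exists i, minI f = f i.
Proof.
move=> n_gt0; apply: (big_ind (fun m => exists i, m = f i)) => [| |i _].
- have: (0 < #|'I_n|)%N by rewrite card_ord.
  by case/(@bigop.eq_bigmax _ f) => i ->; exists i.
- by move=> _ _ [i ->] [j ->]; rewrite /minn; case: ifP; eauto.
- by exists i.
Qed.

Definition nonzero_mixed_sign n (a : 'cV[int]_n) : Prop :=
  [/\ forall i, a i 0 != 0, exists i, 0 < a i 0 & exists i, a i 0 < 0].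

Definition knapsack_sol n (a : 'cV[int]_n) (b : int) (x : 'cV[int]_n) : Prop :=
  a^T *m x = b%:M /\ forall i, 0 <= x i 0.

Definition sparse_sol n (a : 'cV[int]_n) (b : int) (x : 'cV[int]_n) : Prop :=
  knapsack_sol a b x /\
  (norm0 x <= 2 + minI (fun i => omega (`|a i ord0| %/ gcdv a)))%N.

(* Computation model: the random access machine with the logarithmic cost
   criterion, with structured control flow.  A memory cell holds an integer,
   cells are addressed by integers, and executing an operation costs the number
   of bits of the integers it involves.  Up to a polynomial, the cost is the
   running time of a Turing machine. *)

(* A sign bit and ceil (log2 (|z| + 1)) bits for the absolute value. *)
Definition bitsize (z : int) : nat := (up_log 2 `|z|.+1).+1.

Definition memory := int -> int.

Inductive expr : Type :=
  | EConst of int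
  | ECell of expr (* contents of the cell with the given address:
                     [ECell (EConst k)] is direct addressing,
                     [ECell (ECell (EConst k))] is indirect addressing *)
  | EAdd of expr & expr
  | ESub of expr & expr
  | EMul of expr & expr
  | EDiv of expr & expr.

Fixpoint eval (m : memory) (e : expr) : int :=
  match e with
  | EConst k => k
  | ECell e1 => m (eval m e1)
  | EAdd e1 e2 => eval m e1 + eval m e2
  | ESub e1 e2 => eval m e1 - eval m e2
  | EMul e1 e2 => eval m e1 * eval m e2
  | EDiv e1 e2 => (eval m e1 %/ eval m e2)%Z
  end.

(* Every value met during the evaluation is charged with its bit size: operands
   (among them addresses) in the recursive calls, the result by [bitsize]. *)
Fixpoint cost (m : memory) (e : expr) : nat :=
  (match e with
   | EConst _ => 0
   | ECell e1 => cost m e1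
   | EAdd e1 e2 | ESub e1 e2 | EMul e1 e2 | EDiv e1 e2 => cost m e1 + cost m e2
   end + bitsize (eval m e))%N.

Inductive prog : Type :=
  | PSkip
  | PStore of expr & expr (* [PStore e1 e2] writes the value of [e2] at address [e1] *)
  | PSeq of prog & prog
  | PIfPos of expr & prog & prog
  | PWhilePos of expr & prog.

Definition update (m : memory) (k v : int) : memory :=
  fun l => if l == k then v else m l.

(* [exec p m t m']: started in [m], [p] halts in [m'] after time [t]. *)
Inductive exec : prog -> memory -> nat -> memory -> Prop :=
  | ExecSkip m : exec PSkip m 1 m
  | ExecStore e1 e2 m :
      exec (PStore e1 e2) m (cost m e1 + cost m e2).+1
        (update m (eval m e1) (eval m e2))
  | ExecSeq p1 p2 m t1 m1 t2 m2 :
      exec p1 m t1 m1 -> exec p2 m1 t2 m2 -> exec (PSeq p1 p2) m (t1 + t2) m2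
  | ExecIfTrue e p1 p2 m t m' :
      0 < eval m e -> exec p1 m t m' ->
      exec (PIfPos e p1 p2) m (cost m e + t).+1 m'
  | ExecIfFalse e p1 p2 m t m' :
      eval m e <= 0 -> exec p2 m t m' ->
      exec (PIfPos e p1 p2) m (cost m e + t).+1 m'
  | ExecWhileStop e p m :
      eval m e <= 0 -> exec (PWhilePos e p) m (cost m e).+1 m
  | ExecWhileLoop e p m t1 m1 t2 m2 :
      0 < eval m e -> exec p m t1 m1 -> exec (PWhilePos e p) m1 t2 m2 ->
      exec (PWhilePos e p) m (cost m e + t1 + t2).+1 m2.

(* Layout of a list of integers: its length in cell 0, its items in the cells
   1, 2, and so on, and 0 in all other cells. *)
Definition load (s : seq int) : memory := fun k =>
  match k with
  | Posz 0 => (size s)%:Z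
  | Posz i.+1 => s`_i
  | Negz _ => 0
  end.

Definition insize (s : seq int) : nat := (\sum_(z <- s) bitsize z)%N.

(* The cells beyond the output list may contain anything. *)
Definition computes_in (p : prog) (s : seq int) (T : nat) (r : seq int) : Prop :=
  exists t m, [/\ exec p (load s) t m, (t <= T)%N &
    forall k : nat, (k <= size r)%N -> m k%:Z = load r k%:Z].

Definition entries n (x : 'cV[int]_n) : seq int := [seq x i 0 | i <- enum 'I_n].

(* Main.v *)
Require Import Defs.
From mathcomp Require Import all_boot all_order all_algebra.
From mathcomp Require Import zify ring.

Set Implicit Arguments.
Unset Strict Implicit.
Unset Printing Implicit Defensive.

Import Order.TTheory GRing.Theory Num.Theory.
Local Open Scope ring_scope.

(* Fix a root [i] and let [g = gcd(a)].  Run through the indices [j] downwards,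
   maintaining the gcd [d] of [a_i] and of the entries kept so far, and keep
   [a_j] only if [d] and [a_0, ..., a_(j-1)] do not already have gcd [g].  Each
   kept entry removes from [d / g] a prime factor of [a_i / g] for good, so at
   most [omega (|a_i| / g)] entries are kept, and [d] ends at [g].  No integer is
   factored; the program tries all roots and takes the one keeping the fewest
   entries.

   Running back upwards, Bezout cofactors modulo the successive values of [d] give
   [x_j] in [0, |a_i|) for the kept [j] such that [a_i] divides the residual
   [b - sum_j a_j x_j]; the quotient [z] goes to [x_i].  If [a_q] has the sign
   opposite to [a_i], adding [z^2 a_q^2] to [x_i] and [- z^2 a_q a_i] to [x_q] keeps
   the sum and makes all coordinates nonnegative.  The support consists of the kept
   indices, [i] and [q].

   For the running time, all memory contents stay below [2 ^ (10 s)], where [s] is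
   the input size, so every instruction takes time [O(s)], and it remains to
   count instructions. *)

(** * Selection of the entries *)
Section Selection.
Variables (A : nat -> int) (n i : nat).
Local Open Scope nat_scope.

(** Seeding the prefix gcds with [A i] keeps them nonzero as soon as [A i] is, and for [i < n] makes
    [pgcd n] the gcd of all [n] entries. *)
Fixpoint pgcd k := if k is l.+1 then gcdn (pgcd l) `|A l|%N else `|A i|%N.

Definition keep k d := gcdn d (pgcd k) != pgcd n.

Definition sel_step k (p : nat * nat) :=
  if keep k p.1 then (gcdn p.1 `|A k|%N, p.2.+1) else p.

(** [foldr] treats the index [n - 1] first, so this is the state once the indices from [n - 1] down
    to [j] are decided: the current gcd and the number of kept entries. *)
Definition sel j := foldr sel_step (`|A i|%N, 0) (iota j (n - j)).

Lemma sel_n : sel n = (`|A i|%N, 0).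
Proof. by rewrite /sel subnn. Qed.

Lemma sel_recl j : j < n -> sel j = sel_step j (sel j.+1).
Proof. by move=> jn; rewrite /sel -(subnSK jn). Qed.

Lemma pgcd_dvdr k l : l < k -> pgcd k %| `|A l|%N.
Proof.
elim: k => // k IH; rewrite ltnS leq_eqVlt => /orP[/eqP->|/IH lk] /=.
  exact: dvdn_gcdr.
exact: dvdn_trans (dvdn_gcdl _ _) lk.
Qed.

Lemma pgcd_dvdl k : pgcd k %| `|A i|%N.
Proof. by elim: k => //= k; apply: dvdn_trans; apply: dvdn_gcdl. Qed.

Lemma dvdn_pgcd d k :
  d %| `|A i|%N -> (forall l, l < k -> d %| `|A l|%N) -> d %| pgcd k.
Proof.
move=> di; elim: k => //= k IH dA; rewrite dvdn_gcd IH ?dA // => l lk.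
by apply: dA; apply: leq_trans lk _.
Qed.

Lemma pgcd_dvd_pgcd k l : k <= l -> pgcd l %| pgcd k.
Proof.
move=> kl; apply: dvdn_pgcd => [|j jk]; first exact: pgcd_dvdl.
by apply: pgcd_dvdr; apply: leq_trans kl.
Qed.

Lemma dvd_sel_step k p : (sel_step k p).1 %| p.1.
Proof. by rewrite /sel_step; case: ifP => //= _; apply: dvdn_gcdl. Qed.

Lemma sel_ind (P : nat -> nat * nat -> Prop) :
  P n (`|A i|%N, 0) ->
  (forall j, j < n -> P j.+1 (sel j.+1) -> P j (sel j)) ->
  forall j, j <= n -> P j (sel j).
Proof.
move=> Pn Pstep j jn; rewrite -(subKn jn).
elim: (n - j) (leq_subr j n) => [|t IH] tn; first by rewrite subn0 sel_n.
by apply: Pstep; [|rewrite subnSK //; apply: IH]; lia.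
Qed.

Lemma sel_dvdl j : j <= n -> (sel j).1 %| `|A i|%N.
Proof.
move: j; apply: (sel_ind (P := fun _ p => p.1 %| `|A i|%N)) => // j jn.
by apply: dvdn_trans; rewrite sel_recl // dvd_sel_step.
Qed.

(** The index [j] is dropped exactly when the identity already holds at [j] for the old gcd; keeping
    it moves [A j] from the prefix gcd into the selected one. *)
Lemma gcdn_sel_pgcd j : j <= n -> gcdn (sel j).1 (pgcd j) = pgcd n.
Proof.
move: j; apply: (sel_ind (P := fun j p => gcdn p.1 (pgcd j) = pgcd n)) => [|j jn IH] /=.
  by rewrite gcdnC; apply/gcdn_idPl/pgcd_dvdl.
rewrite sel_recl // /sel_step; case: ifP => [_ /=|/negbFE/eqP//].
by rewrite -gcdnA [gcdn _ (pgcd j)]gcdnC.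
Qed.

Lemma sel0 : (sel 0).1 = pgcd n.
Proof. by rewrite -(gcdn_sel_pgcd (leq0n n)); apply/esym/gcdn_idPl/sel_dvdl. Qed.

Lemma pgcd_dvd_sel j : j <= n -> pgcd n %| (sel j).1.
Proof. by move=> /gcdn_sel_pgcd <-; apply: dvdn_gcdl. Qed.

Lemma sel_count j : j <= n -> (sel j).2 = \sum_(j <= k < n) keep k (sel k.+1).1.
Proof.
move: j; apply: (sel_ind (P := fun j p =>
  p.2 = \sum_(j <= k < n) keep k (sel k.+1).1)) => [|j jn IH].
  by rewrite big_geq.
by rewrite big_ltn // -IH sel_recl // /sel_step; case: ifP.
Qed.

Lemma sel_le j : j <= n -> (sel j).2 <= n - j.
Proof.
move=> jn; rewrite sel_count // -[n - j]muln1 -sum_nat_const_nat.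
by apply: leq_sum => k _; apply: leq_b1.
Qed.

Lemma omega_lt d e p : 0 < e -> prime p -> d %| e -> p %| e -> ~~ (p %| d) ->
  omega d < omega e.
Proof.
move=> e_gt0 pp de pe pd; rewrite /omega.
have d_gt0 : 0 < d by apply: dvdn_gt0 de.
apply: (@uniq_leq_size _ (p :: primes d)) => [|q].
  by rewrite /= primes_uniq mem_primes (negPf pd) !andbF.
rewrite inE !mem_primes e_gt0 => /orP[/eqP->|/and3P[-> _ qd]].
    by rewrite pp pe.
  by rewrite (dvdn_trans qd de).
Qed.

Hypothesis Ai_neq0 : A i != 0%R.

Lemma pgcd_gt0 k : 0 < pgcd k.
Proof. by apply: dvdn_gt0 (pgcd_dvdl k); rewrite absz_gt0. Qed.

Lemma sel_gt0 j : j <= n -> 0 < (sel j).1.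
Proof. by move=> jn; apply: dvdn_gt0 (sel_dvdl jn); rewrite absz_gt0. Qed.

(** Let [g = pgcd n]. As [j] is kept, [gcdn d (pgcd j) %/ g] has a prime factor [p], which divides
    [d %/ g]. If [p] also divided the new quotient, [p * g] would divide [d], [pgcd j] and [A j],
    whose gcd is [g]. *)
Lemma keep_omega j d :
  0 < d -> pgcd n %| d -> gcdn d (pgcd j.+1) = pgcd n -> j < n -> keep j d ->
  omega (gcdn d `|A j|%N %/ pgcd n) < omega (d %/ pgcd n).
Proof.
set g := pgcd n => d_gt0 gd dg jn kj.
have g_gt0 : 0 < g by apply: pgcd_gt0.
have gH : g %| gcdn d (pgcd j) by rewrite dvdn_gcd gd pgcd_dvd_pgcd // ltnW.
have h_gt1 : 1 < gcdn d (pgcd j) %/ g.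
  rewrite ltn_neqAle divn_gt0 // dvdn_leq ?gcdn_gt0 ?d_gt0 // andbT.
  by apply: contra kj => /eqP h1; rewrite -(divnK gH) -h1 mul1n.
have gA : g %| gcdn d `|A j|%N by rewrite dvdn_gcd gd pgcd_dvdr.
apply: (@omega_lt _ _ (pdiv (gcdn d (pgcd j) %/ g))).
- by rewrite divn_gt0 // dvdn_leq.
- exact: pdiv_prime.
- by rewrite dvdn_divRL // divnK // dvdn_gcdl.
- by apply: dvdn_trans (pdiv_dvd _) _; rewrite dvdn_divRL // divnK // dvdn_gcdl.
apply/negP => p_dvd; have: pdiv (gcdn d (pgcd j) %/ g) * g %| g.
  rewrite -{3}dg /= !dvdn_gcd; apply/and3P; split.
  - rewrite -dvdn_divRL //; apply: dvdn_trans p_dvd _.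
    by rewrite dvdn_divRL // divnK // dvdn_gcdl.
  - rewrite -dvdn_divRL; last by apply: dvdn_trans gH _; apply: dvdn_gcdr.
    apply: dvdn_trans (pdiv_dvd _) _.
    rewrite dvdn_divRL; first by rewrite divnK // dvdn_gcdr.
    by apply: dvdn_trans gH _; apply: dvdn_gcdr.
  - rewrite -dvdn_divRL; last exact: pgcd_dvdr.
    apply: dvdn_trans p_dvd _.
    by rewrite dvdn_divRL ?pgcd_dvdr // divnK // dvdn_gcdr.
move/dvdn_leq => /(_ g_gt0); have := prime_gt1 (pdiv_prime h_gt1).
by case: (pdiv _) => // -[//|p] _; rewrite mulSn; nia.
Qed.

(** The left side is a potential that never grows on the way down: a kept entry adds one to the
    count and costs at least one prime. *)
Lemma sel_omega j : j <= n ->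
  (sel j).2 + omega ((sel j).1 %/ pgcd n) <= omega (`|A i|%N %/ pgcd n).
Proof.
move: j; apply: (sel_ind (P := fun j p =>
  p.2 + omega (p.1 %/ pgcd n) <= omega (`|A i|%N %/ pgcd n))) => // j jn IH.
rewrite sel_recl // /sel_step; case: ifP => //= kj; apply: leq_trans IH.
rewrite addSnnS leq_add2l keep_omega //; first exact: sel_gt0.
  exact: pgcd_dvd_sel.
exact: gcdn_sel_pgcd.
Qed.

End Selection.

(** * Program logic *)
(** A constant weighs more than its absolute value, hence more than its bit length, so that
    [K * esize e] can bound the bits of every intermediate value. *)
Fixpoint esize (e : expr) : nat :=
  match e with
  | EConst k => `|k|.+1
  | ECell e1 => (esize e1).+1
  | EAdd e1 e2 | ESub e1 e2 | EMul e1 e2 | EDiv e1 e2 => (esize e1 + esize e2).+1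
  end%N.

Fixpoint psize (p : prog) : nat :=
  match p with
  | PSkip => 1
  | PStore e1 e2 => (esize e1 + esize e2).+1
  | PSeq p1 p2 => psize p1 + psize p2
  | PIfPos e p1 p2 => (esize e + psize p1 + psize p2).+1
  | PWhilePos e p1 => (esize e + psize p1).+1
  end%N.

Definition fits (k : nat) (z : int) := (`|z| <= 2 ^ k)%N.

Lemma fits_le k l z : (k <= l)%N -> fits k z -> fits l z.
Proof. by move=> kl /leq_trans; apply; rewrite leq_exp2l. Qed.

Lemma fitsN k z : fits k (- z) = fits k z.
Proof. by rewrite /fits abszN. Qed.

Lemma fitsD k l y z : fits k y -> fits l z -> fits (maxn k l).+1 (y + z).
Proof.
move=> /(fits_le (leq_maxl k l)) fy /(fits_le (leq_maxr k l)) fz.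
by rewrite /fits expnS; move: fy fz; rewrite /fits; lia.
Qed.

Lemma fitsB k l y z : fits k y -> fits l z -> fits (maxn k l).+1 (y - z).
Proof. by move=> fy fz; apply: fitsD; rewrite ?fitsN. Qed.

Lemma fitsM k l y z : fits k y -> fits l z -> fits (k + l) (y * z).
Proof. by rewrite /fits abszM expnD; apply: leq_mul. Qed.

Lemma fits_div k y z : fits k y -> fits k (y %/ z)%Z.
Proof. by apply: leq_trans; have := lez_div y z; lia. Qed.

Lemma fits_bitsize z : fits (bitsize z) z.
Proof.
rewrite /fits /bitsize expnS; have := up_logP `|z|.+1 (isT : 1 < 2)%N; lia.
Qed.

Lemma bitsize_le k z : fits k z -> (bitsize z <= k.+2)%N.
Proof.
move=> fz; rewrite ltnS; apply: up_log_min => //; rewrite expnS.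
by move: fz; rewrite /fits; have : (0 < 2 ^ k)%N; [rewrite expn_gt0|lia].
Qed.

Section Cost.
Variable K : nat.
Hypothesis K_gt0 : (0 < K)%N.

Definition bounded (m : memory) := forall l, fits K (m l).

Lemma fits_eval m e : bounded m -> fits (K * esize e) (eval m e).
Proof.
move=> bm; elim: e => [k|e _|e1 IH1 e2 IH2|e1 IH1 e2 IH2|e1 IH1 e2 IH2|e1 IH1 e2 IH2] /=.
- apply: (@fits_le `|k|); first by case: K K_gt0 => // K' _; rewrite mulSn; lia.
  by rewrite /fits ltnW // ltn_expl.
- by apply: fits_le (bm _); rewrite mulnS leq_addr.
- by apply: fits_le (fitsD IH1 IH2); rewrite mulnS mulnDr; lia.
- by apply: fits_le (fitsB IH1 IH2); rewrite mulnS mulnDr; lia.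
- by apply: fits_le (fitsM IH1 IH2); rewrite mulnS mulnDr; lia.
- by apply: fits_le (fits_div _ IH1); rewrite mulnS mulnDr; lia.
Qed.

(** A quadratic bound is superadditive with room left for the charge of the root node; this is the
    induction step of [cost_le]. *)
Lemma square_bound_add s1 s2 :
  (s1 * (K * s1 + 2) + s2 * (K * s2 + 2) + (K * (s1 + s2).+1 + 2) <=
   (s1 + s2).+1 * (K * (s1 + s2).+1 + 2))%N.
Proof.
rewrite [X in (_ <= X)%N]mulSn addnC leq_add2l mulnDl.
by rewrite leq_add // leq_mul // leq_add2r leq_mul //; lia.
Qed.

Lemma cost_le m e : bounded m -> (cost m e <= esize e * (K * esize e + 2))%N.
Proof.
move=> bm; have bs e' : (bitsize (eval m e') <= K * esize e' + 2)%N.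
  by rewrite addn2; apply: bitsize_le; apply: fits_eval.
elim: e => [k|e IH|e1 IH1 e2 IH2|e1 IH1 e2 IH2|e1 IH1 e2 IH2|e1 IH1 e2 IH2].
- by rewrite [cost _ _]add0n; apply: leq_trans (bs _) _; rewrite leq_pmull.
- apply: (leq_trans (leq_add IH (bs (ECell e)))).
  by have := square_bound_add (esize e) 0; rewrite !addn0.
- exact: leq_trans (leq_add (leq_add IH1 IH2) (bs (EAdd e1 e2))) (square_bound_add _ _).
- exact: leq_trans (leq_add (leq_add IH1 IH2) (bs (ESub e1 e2))) (square_bound_add _ _).
- exact: leq_trans (leq_add (leq_add IH1 IH2) (bs (EMul e1 e2))) (square_bound_add _ _).
- exact: leq_trans (leq_add (leq_add IH1 IH2) (bs (EDiv e1 e2))) (square_bound_add _ _).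
Qed.

Definition ucost (p : prog) := (psize p * (K * psize p + 2))%N.

(* Total correctness; the postcondition also receives the number of executed
   instructions and tests, each of which takes time at most [ucost p]. *)
Definition wp p m (Q : nat -> memory -> Prop) :=
  bounded m -> exists N t m',
    [/\ exec p m t m', (t <= N * ucost p)%N, bounded m' & Q N m'].

Lemma ucost_le p p' : (psize p <= psize p')%N -> (ucost p <= ucost p')%N.
Proof. by move=> pp; apply: leq_mul; rewrite // leq_add2r leq_mul. Qed.

Lemma wp_mono p m (Q Q' : nat -> memory -> Prop) :
  wp p m Q -> (forall N m', Q N m' -> Q' N m') -> wp p m Q'.
Proof.
move=> wpQ QQ' /wpQ[N [t [m' [ex tN bm' q]]]].
by exists N, t, m'; split=> //; apply: QQ'.
Qed.

Lemma wp_skip m (Q : nat -> memory -> Prop) : Q 1%N m -> wp PSkip m Q.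
Proof.
move=> q bm; exists 1%N, 1%N, m; split=> //; first exact: ExecSkip.
by rewrite mul1n /ucost mul1n addn2.
Qed.

(** Only stores change the memory, so the bound on the written value is all that is needed to keep
    the memory bounded. *)
Lemma wp_store e1 e2 m (Q : nat -> memory -> Prop) :
  fits K (eval m e2) -> Q 1%N (update m (eval m e1) (eval m e2)) ->
  wp (PStore e1 e2) m Q.
Proof.
move=> f2 q bm; exists 1%N, (cost m e1 + cost m e2).+1; eexists; split.
- exact: ExecStore.
- rewrite mul1n; apply: leq_trans (square_bound_add _ _).
  by rewrite -addn1 leq_add ?leq_add ?cost_le // addn2.
- by move=> l; rewrite /update; case: ifP => _; [exact: f2|exact: bm].
- exact: q.
Qed.

Lemma wp_seq p1 p2 m (Q : nat -> memory -> Prop) :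
  wp p1 m (fun N1 m1 => wp p2 m1 (fun N2 m2 => Q (N1 + N2)%N m2)) ->
  wp (PSeq p1 p2) m Q.
Proof.
move=> w1 /w1[N1 [t1 [m1 [ex1 t1N bm1 /(_ bm1)[N2 [t2 [m2 [ex2 t2N bm2 q]]]]]]]].
exists (N1 + N2)%N, (t1 + t2)%N, m2; split=> //; first exact: ExecSeq ex1 ex2.
rewrite mulnDl leq_add //.
  by apply: leq_trans t1N _; rewrite leq_mul // ucost_le // leq_addr.
by apply: leq_trans t2N _; rewrite leq_mul // ucost_le // leq_addl.
Qed.

Lemma test_le m e p : bounded m -> (esize e < psize p)%N ->
  ((cost m e).+1 <= ucost p)%N.
Proof.
move=> bm ep; have := cost_le e bm; rewrite /ucost.
have : (esize e * (K * esize e + 2) < psize p * (K * psize p + 2))%N.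
  by apply: ltn_mul; rewrite // ltn_add2r ltn_pmul2l.
lia.
Qed.

Lemma wp_if e p1 p2 m (Q : nat -> memory -> Prop) :
  (0 < eval m e -> wp p1 m (fun N m' => Q N.+1 m')) ->
  (eval m e <= 0 -> wp p2 m (fun N m' => Q N.+1 m')) ->
  wp (PIfPos e p1 p2) m Q.
Proof.
move=> w1 w2 bm; have ct := test_le bm (_ : esize e < psize (PIfPos e p1 p2))%N.
case: (ltrP 0 (eval m e)) => [/[dup] ev /w1|/[dup] ev /w2] /(_ bm)
  [N [t [m' [ex tN bm' q]]]].
- exists N.+1, (cost m e + t).+1, m'; split=> //; first exact: ExecIfTrue.
  rewrite mulSn -addSn leq_add //; first by apply: ct; rewrite /=; lia.
  by apply: leq_trans tN _; rewrite leq_mul // ucost_le //=; lia.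
- exists N.+1, (cost m e + t).+1, m'; split=> //; first exact: ExecIfFalse.
  rewrite mulSn -addSn leq_add //; first by apply: ct; rewrite /=; lia.
  by apply: leq_trans tN _; rewrite leq_mul // ucost_le //=; lia.
Qed.

(** The index of the invariant is a variant: a positive guard makes it a successor, and the body
    lowers it by one. Each round takes at most [C] steps and a test, and one last test fails. *)
Lemma wp_while (I : nat -> memory -> Prop) C f e p m (Q : nat -> memory -> Prop) :
  I f m ->
  (forall k m, I k m -> 0 < eval m e -> exists2 k', k = k'.+1 &
     wp p m (fun N m' => (N <= C)%N /\ I k' m')) ->
  (forall N k m, (N <= f * C.+1 + 1)%N -> I k m -> eval m e <= 0 -> Q N m) ->
  wp (PWhilePos e p) m Q.
Proof.
move=> If step fin; apply: (@wp_mono _ _ (fun N m' => (N <= f * C.+1 + 1)%N /\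
   (eval m' e <= 0 /\ exists k, I k m'))); last first.
  by move=> N m' [N_le [ev [k Ik]]]; apply: fin Ik ev.
elim: f m If {fin} => [|f IH] m If bm;
  have ct : ((cost m e).+1 <= ucost (PWhilePos e p))%N
    by (apply: test_le => //=; lia).
- case: (lerP (eval m e) 0) => [ev|/(step _ _ If)[]//].
  exists 1%N, (cost m e).+1, m; split=> //; first exact: ExecWhileStop.
    by rewrite mul1n.
  by split=> //; split=> //; exists 0%N.
case: (lerP (eval m e) 0) => [ev|/[dup] ev /(step _ _ If)[_ [<-]]].
  exists 1%N, (cost m e).+1, m; split=> //; first exact: ExecWhileStop.
    by rewrite mul1n.
  by split; [lia|split=> //; exists f.+1].
move=> /(_ bm)[N1 [t1 [m1 [ex1 t1N bm1 [N1C /IH/(_ bm1)]]]]].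
move=> [N2 [t2 [m2 [ex2 t2N bm2 [N2C q]]]]].
exists (1 + N1 + N2)%N, (cost m e + t1 + t2).+1, m2; split => //.
- exact: ExecWhileLoop ex1 ex2.
- rewrite !mulnDl mul1n -!addSn !leq_add //.
  by apply: leq_trans t1N _; rewrite leq_mul // ucost_le //=; lia.
- by split=> //; nia.
Qed.

End Cost.

(** * Memory layout and symbolic execution *)

Inductive kind := Inp | Sc | Wa | Va.

(* The nonnegative addresses hold the input list, later overwritten by the output;
   scalars and two arrays share the negative ones according to the residue
   modulo 3. *)
Definition addr (c : kind) (k : nat) : int :=
  match c with
  | Inp => k%:Z
  | Sc => Negz (3 * k)
  | Wa => Negz (3 * k).+1
  | Va => Negz (3 * k).+2
  end.

Definition same_kind c c' :=
  match c, c' with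
  | Inp, Inp | Sc, Sc | Wa, Wa | Va, Va => true
  | _, _ => false
  end.

Lemma addr_eq c k c' k' : (addr c k == addr c' k') = same_kind c c' && (k == k').
Proof.
apply/eqP/andP => [|[]]; last by case: c; case: c' => // _ /eqP->.
by case: c; case: c' => /= kk; split => //; lia.
Qed.

Lemma updateE m c k v c' k' : update m (addr c k) v (addr c' k') =
  if same_kind c' c && (k' == k) then v else m (addr c' k').
Proof. by rewrite /update addr_eq. Qed.

Definition eS k := ECell (EConst (addr Sc k)).
(* The list b, a_0, a_1 ... starts at address 1, and so does the output. *)
Definition aIn e := EAdd e (EConst 2).
Definition aOut e := EAdd e (EConst 1).
Definition aW e := ESub (EConst (-2)) (EMul (EConst 3) e).
Definition aV e := ESub (EConst (-3)) (EMul (EConst 3) e).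
Definition emod e1 e2 := ESub e1 (EMul (EDiv e1 e2) e2).
(* Integer division rounds down, hence -1 %/ z is minus the sign of z. *)
Definition eabs e := ESub (EConst 0) (EMul e (EDiv (EConst (-1)) e)).
Definition set_ k e := PStore (EConst (addr Sc k)) e.

Lemma eval_S m k : eval m (eS k) = m (addr Sc k). Proof. by []. Qed.
Lemma eval_const m z : eval m (EConst z) = z. Proof. by []. Qed.
Lemma eval_cell m e : eval m (ECell e) = m (eval m e). Proof. by []. Qed.
Lemma eval_add m e1 e2 : eval m (EAdd e1 e2) = eval m e1 + eval m e2.
Proof. by []. Qed.
Lemma eval_sub m e1 e2 : eval m (ESub e1 e2) = eval m e1 - eval m e2.
Proof. by []. Qed.
Lemma eval_mul m e1 e2 : eval m (EMul e1 e2) = eval m e1 * eval m e2.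
Proof. by []. Qed.
Lemma eval_div m e1 e2 : eval m (EDiv e1 e2) = (eval m e1 %/ eval m e2)%Z.
Proof. by []. Qed.
Lemma eval_mod m e1 e2 : eval m (emod e1 e2) = (eval m e1 %% eval m e2)%Z.
Proof. by []. Qed.
Lemma eval_abs m e : eval m (eabs e) = `|eval m e|%N%:Z.
Proof.
rewrite /= sub0r; case: (eval m e) => [[|k]|k]; rewrite // /divz /= div0n; lia.
Qed.

Definition addrIn z : int := z + 2.
Definition addrOut z : int := z + 1.
Definition addrW z : int := -2 - 3 * z.
Definition addrV z : int := -3 - 3 * z.
Lemma eval_aIn m e : eval m (aIn e) = addrIn (eval m e). Proof. by []. Qed.
Lemma eval_aOut m e : eval m (aOut e) = addrOut (eval m e). Proof. by []. Qed.
Lemma eval_aW m e : eval m (aW e) = addrW (eval m e). Proof. by []. Qed.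
Lemma eval_aV m e : eval m (aV e) = addrV (eval m e). Proof. by []. Qed.
Lemma addrInE (k : nat) : addrIn k = addr Inp k.+2. Proof. rewrite /addrIn /addr; lia. Qed.
Lemma addrOutE (k : nat) : addrOut k = addr Inp k.+1. Proof. rewrite /addrOut /addr; lia. Qed.
Lemma addrWE (k : nat) : addrW k = addr Wa k. Proof. rewrite /addrW /addr; lia. Qed.
Lemma addrVE (k : nat) : addrV k = addr Va k. Proof. rewrite /addrV /addr; lia. Qed.

(** Derived operations precede the primitive ones, so that they are recognised before being
    unfolded. *)
Definition evalE :=
  (eval_abs, eval_mod, eval_aIn, eval_aOut, eval_aW, eval_aV, eval_S, eval_const,
   eval_cell, eval_add, eval_sub, eval_mul, eval_div).

Arguments addr : simpl never.
Arguments update : simpl never.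
Arguments addrIn : simpl never.
Arguments addrOut : simpl never.
Arguments addrW : simpl never.
Arguments addrV : simpl never.
Arguments eval : simpl never.

(** Frame condition: [P] selects the cells that a piece of program leaves untouched. *)
Definition agree (P : kind -> nat -> bool) (m m' : memory) :=
  forall c k, P c k -> m' (addr c k) = m (addr c k).

Lemma agree_update P m m' c k v :
  agree P m m' -> ~~ P c k -> agree P m (update m' (addr c k) v).
Proof.
move=> mm' nP c' k' P'; rewrite updateE; case: ifP => [/andP[cc /eqP kk]|_].
  by move: P'; rewrite kk (_ : c' = c) ?(negPf nP) //; case: c' c cc {nP} => -[].
exact: mm'.
Qed.

Lemma agree_trans (P P' : kind -> nat -> bool) m1 m2 m3 :
  agree P m1 m2 -> agree P' m2 m3 -> (forall c k, P c k -> P' c k) -> agree P m1 m3.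
Proof. by move=> a12 a23 PP c k Pck; rewrite a23 ?PP // a12. Qed.

Notation "p ;; q" := (PSeq p q) (at level 60, right associativity).

Ltac wp_set := apply: wp_store; [assumption|rewrite ?evalE ?updateE /=..].
Ltac wp_next := apply: wp_seq; wp_set.

(** * Extended Euclid *)
(* R0 and R1 are the remainders of the Euclidean algorithm for DD and YY, with
   Ri = Vi * YY modulo DD. *)
Notation R0 := 0%N (only parsing).
Notation R1 := 1%N (only parsing).
Notation V0 := 2%N (only parsing).
Notation V1 := 3%N (only parsing).
Notation QQ := 4%N (only parsing).
Notation TT := 5%N (only parsing).
Notation DD := 6%N (only parsing).
Notation YY := 7%N (only parsing).

(** Only the cofactor of [YY] is tracked, and it is reduced modulo [DD] in each round, which bounds
    its size without any analysis of its growth. *)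
Definition gcd_loop :=
  set_ QQ (EDiv (eS R0) (eS R1));;
  set_ TT (emod (eS R0) (eS R1));;
  set_ R0 (eS R1);;
  set_ R1 (eS TT);;
  set_ TT (ESub (eS V0) (EMul (eS QQ) (eS V1)));;
  set_ V0 (eS V1);;
  set_ V1 (emod (eS TT) (eS DD)).

Definition gcd_prog :=
  set_ R0 (eS DD);;
  set_ R1 (emod (eS YY) (eS DD));;
  set_ V0 (EConst 0);;
  set_ V1 (EConst 1);;
  PWhilePos (eS R1) gcd_loop.

(** The arguments [DD] and [YY] survive a call, which lets [keep_prog] reuse [DD]. *)
Definition gcd_keeps c k := if c is Sc then (6 <= k)%N else true.

Section Gcd.
Variables (K s : nat).
Hypothesis K_ge : (10 * s <= K)%N.
Hypothesis s_gt0 : (0 < s)%N.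

Let K_gt0 : (0 < K)%N. Proof. lia. Qed.

Variables (m0 : memory) (d : nat) (y : int).
Hypotheses (d_gt0 : (0 < d)%N) (d_le : (d <= 2 ^ s)%N).
Hypotheses (m0D : m0 (addr Sc DD) = d) (m0Y : m0 (addr Sc YY) = y).

Definition gcd_inv k m := exists (r0 r1 : nat) (v0 v1 : int),
  [/\ agree gcd_keeps m0 m,
      [/\ m (addr Sc R0) = r0, m (addr Sc R1) = r1,
          m (addr Sc V0) = v0 & m (addr Sc V1) = v1],
      [/\ fits s v0, fits s v1, (r1 <= r0 <= d)%N & (r0 * r1 < 2 ^ k)%N],
      gcdn r0 r1 = gcdn d `|y|%N &
      (d %| v0 * y - r0%:Z)%Z /\ (d %| v1 * y - r1%:Z)%Z].

Lemma fits_nat k (l : nat) : (l <= 2 ^ k)%N -> fits k l.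
Proof. by []. Qed.

Lemma fits_modz (z : int) : fits s (z %% d)%Z.
Proof.
rewrite /fits; apply: leq_trans d_le.
have d0 : d%:Z != 0 by lia.
by have := ltz_mod z d0; have := modz_ge0 z d0; lia.
Qed.

(* The product of the remainders halves in each iteration. *)
Lemma wp_gcd_loop k m : gcd_inv k m -> 0 < eval m (eS R1) ->
  exists2 k', k = k'.+1 &
    wp K gcd_loop m (fun N m' => (N <= 7)%N /\ gcd_inv k' m').
Proof.
move=> [r0 [r1 [v0 [v1 [ag [mr0 mr1 mv0 mv1]]]]]].
move=> [fv0 fv1 /andP[r10 r0d] r01] eg [dv0 dv1].
rewrite evalE mr1 => r1_gt0.
case: k r01 => [|k] r01; first by move: r01; nia.
exists k => //.
have mD : m (addr Sc DD) = d by rewrite ag.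
have fr0 : fits s r0 by apply/fits_nat/(leq_trans r0d).
have fr1 : fits s r1 by apply/fits_nat/(leq_trans r10)/(leq_trans r0d).
wp_next; rewrite mr0 mr1.
  by apply: fits_le (fits_div _ fr0); lia.
wp_next; rewrite mr0 mr1 modz_nat.
  by apply: fits_le (fits_nat (leq_trans (leq_mod r0 r1) fr0)); lia.
wp_next; rewrite mr1.
  by apply: fits_le fr1; lia.
wp_next.
  by apply: fits_le (fits_nat (leq_trans (leq_mod r0 r1) fr0)); lia.
wp_next; rewrite mv0 mv1.
  by apply: fits_le (fitsB fv0 (fitsM (fits_div _ fr0) fv1)); lia.
wp_next; rewrite mv1.
  by apply: fits_le fv1; lia.
wp_set; rewrite mD.
  by apply: fits_le (fits_modz _); lia.
have rr : (r0 %% r1 < r1)%N by rewrite ltn_pmod.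
split=> //; exists r1, (r0 %% r1)%N, v1, ((v0 - (r0 %/ r1)%Z * v1) %% d)%Z.
split.
- by do 7!apply: agree_update => //.
- by split; rewrite !updateE.
- split=> //; first exact: fits_modz.
    by rewrite (ltnW rr) (leq_trans r10).
  (* As [r1 <= r0], the quotient is at least 1, so [r0] is at least [r1] plus the remainder, hence
     at least twice the remainder. *)
  have h : (r0 %% r1 + r0 %% r1 <= r0)%N.
    rewrite [X in (_ <= X)%N](divn_eq r0 r1) leq_add2r (leq_trans (ltnW rr)) //.
    by rewrite leq_pmull // divn_gt0.
  move: r01 (leq_mul h (leqnn r1)).
  by rewrite expnS mulnDl [(r1 * _)%N]mulnC; lia.
- by rewrite gcdn_modr gcdnC.
split=> //.
set q := (r0 %/ r1)%Z; set v := v0 - q * v1.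
(* The new congruence combines the two old ones, up to the multiple of [d] removed by the
   reduction. *)
have -> : (v %% d)%Z * y - (r0 %% r1)%N%:Z =
   (v0 * y - r0%:Z) - q * (v1 * y - r1%:Z) - (v %/ d)%Z * y * d.
  rewrite /modz -modz_nat /modz -/q {1}/v; ring.
rewrite rpredB ?dvdz_mull //.
by rewrite rpredB ?dvdz_mull.
Qed.

Lemma wp_gcd (Q : nat -> memory -> Prop) :
  (forall N m, (N <= 16 * s + 5)%N -> agree gcd_keeps m0 m ->
     m (addr Sc R0) = gcdn d `|y|%N -> fits s (m (addr Sc V0)) ->
     (d %| m (addr Sc V0) * y - (gcdn d `|y|%N)%:Z)%Z -> Q N m) ->
  wp K gcd_prog m0 Q.
Proof.
move=> post.
wp_next; rewrite m0D; first by apply: fits_le (fits_nat d_le); lia.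
wp_next; rewrite m0D m0Y; first by apply: fits_le (fits_modz _); lia.
wp_next; first by rewrite /fits.
wp_next; first by rewrite /fits expn_gt0.
have d0 : d%:Z != 0 by lia.
have [r y_mod] : exists r : nat, (y %% d)%Z = r.
  by exists `|(y %% d)%Z|%N; rewrite gez0_abs // modz_ge0.
(* Initially [r0 = d <= 2 ^ s] and [r1 < d], so the product is below [2 ^ (2 * s)]. *)
apply: (@wp_while K K_gt0 gcd_inv 7 (2 * s)).
- exists d, r, 0, 1; split.
  + by do 4!apply: agree_update => //.
  + by split; rewrite !updateE.
  + have rd : (r < d)%N by have := ltz_mod y d0; rewrite y_mod; lia.
    split; rewrite /fits ?expn_gt0 ?leqnn ?andbT ?(ltnW rd) //.
    by rewrite mul2n -addnn expnD; nia.
  + by have := gcdz_modr d y; rewrite y_mod /gcdz => -[].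
  + rewrite mul0r sub0r mul1r -y_mod; split; first by rewrite rpredN dvdzz.
    by rewrite /modz opprB addrC subrK dvdz_mull.
- exact: wp_gcd_loop.
move=> N k m N_le [r0 [r1 [v0 [v1 [ag [mr0 mr1 mv0 mv1] [fv0 _ _ _] eg [dv0 _]]]]]].
rewrite evalE mr1 => r1_le0.
have r10 : r1 = 0%N by lia.
move: eg; rewrite r10 gcdn0 => eg.
apply: post; rewrite ?mv0 -?eg //; lia.
Qed.

End Gcd.

(** * The selection program *)
Notation JJ := 8%N (only parsing).
Notation DC := 9%N (only parsing).
Notation CNT := 10%N (only parsing).
Notation GG := 11%N (only parsing).
Notation AI := 12%N (only parsing).
Notation NN := 13%N (only parsing).
Notation II := 14%N (only parsing).

(** All prefix gcds are stored, because the downward pass reads them in reverse order. *)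
Definition pgcd_loop :=
  set_ DD (ECell (aW (eS JJ)));;
  set_ YY (ECell (aIn (eS JJ)));;
  gcd_prog;;
  set_ JJ (EAdd (eS JJ) (EConst 1));;
  PStore (aW (eS JJ)) (eS R0).

Definition keep_prog :=
  set_ YY (ECell (aIn (eS JJ)));;
  gcd_prog;;
  set_ DC (eS R0);;
  PStore (aV (eS JJ)) (eS V0);;
  set_ CNT (EAdd (eS CNT) (EConst 1)).

(** Once the prefix gcd at [JJ] has been read, its cell is reused for the selected gcd: the array
    holds prefix gcds below [JJ] and selected gcds from [JJ] on. A dropped entry gets the cofactor
    0. *)
Definition sel_loop :=
  set_ JJ (ESub (eS JJ) (EConst 1));;
  set_ DD (eS DC);;
  set_ YY (ECell (aW (eS JJ)));;
  gcd_prog;;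
  PIfPos (ESub (eS R0) (eS GG)) keep_prog (PStore (aV (eS JJ)) (EConst 0));;
  PStore (aW (eS JJ)) (eS DC).

Definition sel_prog :=
  set_ AI (ECell (aIn (eS II)));;
  set_ DC (eabs (eS AI));;
  set_ JJ (EConst 0);;
  PStore (aW (eS JJ)) (eS DC);;
  PWhilePos (ESub (eS NN) (eS JJ)) pgcd_loop;;
  set_ GG (ECell (aW (eS NN)));;
  set_ CNT (EConst 0);;
  PWhilePos (eS JJ) sel_loop.

Definition sel_keeps c k :=
  match c with Inp => true | Sc => (13 <= k)%N | _ => false end.

Lemma gcd_sel_keeps c k : sel_keeps c k -> gcd_keeps c k.
Proof. by case: c => //=; apply: leq_trans. Qed.

Section Select.
Variables (K s : nat).
Hypothesis K_ge : (10 * s <= K)%N.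
Hypothesis s_gt0 : (0 < s)%N.

Let K_gt0 : (0 < K)%N. Proof. lia. Qed.

Variables (A : nat -> int) (n i : nat).
Hypotheses (i_lt : (i < n)%N) (n_le : (n <= s)%N).
Hypothesis A_fits : forall k, fits s (A k).
Hypothesis A_neq0 : forall k, (k < n)%N -> A k != 0.

Variable m0 : memory.
Hypothesis m0N : m0 (addr Sc NN) = n.
Hypothesis m0I : m0 (addr Sc II) = i.
Hypothesis m0A : forall k, (k < n)%N -> m0 (addr Inp k.+2) = A k.

Local Notation pg := (pgcd A i).
Local Notation sel := (sel A n i).

(* A step of the upward pass uses only the congruence: it lets a multiple of the
   value of [d] at [k] become one of the value at [k.+1] by subtracting a multiple
   of [A k]. *)
Definition cofactor_spec k (v : int) :=
  [/\ fits s v, ((sel k.+1).1 %| v * A k - (sel k).1%:Z)%Z &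
      v != 0 -> keep A n i k (sel k.+1).1].

Lemma fits_index k : (k <= n)%N -> fits s k.
Proof.
move=> kn; apply: fits_nat; apply: ltnW; apply: leq_ltn_trans (ltn_expl s _) => //.
exact: leq_trans n_le.
Qed.

Lemma fits_pgcd k : fits s (pg k).
Proof.
apply: fits_nat; apply: leq_trans (A_fits i).
by apply: dvdn_leq; [rewrite absz_gt0 A_neq0|apply: pgcd_dvdl].
Qed.

Lemma fits_sel k : (k <= n)%N -> fits s (sel k).1.
Proof.
move=> kn; apply: fits_nat; apply: leq_trans (A_fits i).
by apply: dvdn_leq; [rewrite absz_gt0 A_neq0|apply: sel_dvdl].
Qed.

Definition pgcd_inv f m := exists j : nat,
  [/\ f = (n - j)%N, (j <= n)%N, agree sel_keeps m0 m,
      [/\ m (addr Sc JJ) = j, m (addr Sc AI) = A i & m (addr Sc DC) = `|A i|%N] &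
      forall l, (l <= j)%N -> m (addr Wa l) = pg l].

Definition sel_inv j m :=
  [/\ (j <= n)%N, agree sel_keeps m0 m,
      [/\ m (addr Sc JJ) = j, m (addr Sc AI) = A i, m (addr Sc DC) = (sel j).1,
          m (addr Sc CNT) = (sel j).2 & m (addr Sc GG) = pg n],
      forall l, (l < j)%N -> m (addr Wa l) = pg l &
      forall l, (j <= l < n)%N ->
        m (addr Wa l) = (sel l).1 /\ cofactor_spec l (m (addr Va l))].

Lemma wp_pgcd_loop k m : pgcd_inv k m -> 0 < eval m (ESub (eS NN) (eS JJ)) ->
  exists2 k', k = k'.+1 &
    wp K pgcd_loop m (fun N m' => (N <= 16 * s + 9)%N /\ pgcd_inv k' m').
Proof.
move=> [j [kE jn ag [mJ mAI mDC] mW]].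
have mN : m (addr Sc NN) = n by rewrite ag.
rewrite !evalE mN mJ subr_gt0 ltz_nat => jltn.
exists (n - j.+1)%N; first lia.
wp_next; rewrite mJ addrWE mW //.
  by apply: fits_le (fits_pgcd _); lia.
wp_next; rewrite mJ addrInE updateE /= ag // m0A //.
  by apply: fits_le (A_fits j); lia.
apply: wp_seq; apply: (@wp_gcd K s K_ge s_gt0 _ (pg j) (A j)) => //.
  by rewrite pgcd_gt0 // A_neq0.
  exact: fits_pgcd.
move=> N1 m1 N1_le ag1 mR0 _ _.
have mJ1 : m1 (addr Sc JJ) = j by rewrite ag1 // !updateE.
have jE : j%:Z + 1 = j.+1 by lia.
wp_next; rewrite mJ1 jE.
  by apply: fits_le (fits_index jltn); lia.
wp_set; rewrite mR0.
  by apply: fits_le (fits_pgcd j.+1); lia.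
split; first lia.
rewrite addrWE.
exists j.+1; split=> //.
- do 2!apply: agree_update => //.
  apply: agree_trans ag1 gcd_sel_keeps.
  by do 2!apply: agree_update => //.
- by rewrite !updateE /= !ag1 // !updateE.
- move=> l; rewrite !updateE /=; case: eqP => [-> //|/eqP lj l_le].
  by rewrite ag1 // !updateE /= mW //; lia.
Qed.

Lemma wp_sel_loop k m : sel_inv k m -> 0 < eval m (eS JJ) ->
  exists2 k', k = k'.+1 &
    wp K sel_loop m (fun N m' => (N <= 32 * s + 19)%N /\ sel_inv k' m').
Proof.
move=> [kn ag [mJ mAI mDC mC mG] mW mV].
rewrite evalE mJ; case: k kn mJ mDC mC mW mV => // j jn mJ mDC mC mW mV _.
exists j => //.
have Ai_neq0 : A i != 0 by rewrite A_neq0.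
have sel_pos := sel_gt0 Ai_neq0 jn.
have fsel := fits_sel jn.
have jE : j.+1%:Z - 1 = j by lia.
wp_next; rewrite mJ jE.
  by apply: fits_le (fits_index (ltnW jn)); lia.
wp_next; rewrite mDC.
  by apply: fits_le fsel; lia.
wp_next; rewrite addrWE updateE /= updateE /= mW //.
  by apply: fits_le (fits_pgcd _); lia.
apply: wp_seq; apply: (@wp_gcd K s K_ge s_gt0 _ ((sel j.+1).1) (pg j)) => //.
move=> N1 m1 N1_le ag1 mR0 _ _.
have mJ1 : m1 (addr Sc JJ) = j by rewrite ag1 // !updateE.
have mDC1 : m1 (addr Sc DC) = (sel j.+1).1 by rewrite ag1 // !updateE.
have mD1 : m1 (addr Sc DD) = (sel j.+1).1 by rewrite ag1 // !updateE.
have mG1 : m1 (addr Sc GG) = pg n by rewrite ag1 // !updateE.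
have mC1 : m1 (addr Sc CNT) = (sel j.+1).2 by rewrite ag1 // !updateE.
have mAI1 : m1 (addr Sc AI) = A i by rewrite ag1 // !updateE.
have ag01 : agree sel_keeps m0 m1.
  apply: agree_trans ag1 gcd_sel_keeps.
  by do 3!apply: agree_update => //.
have mW1 l : (l < j)%N -> m1 (addr Wa l) = pg l.
  by move=> lj; rewrite ag1 // !updateE /= mW // ltnW.
have mV1 l : (j < l < n)%N ->
    m1 (addr Wa l) = (sel l).1 /\ cofactor_spec l (m1 (addr Va l)).
  by move=> lj; rewrite !ag1 // !updateE /=; apply: mV.
have sel_j : sel j = sel_step A n i j (sel j.+1) by rewrite sel_recl.
have g_dvd : (pg n %| gcdn (sel j.+1).1 (pg j))%N.
  by rewrite dvdn_gcd pgcd_dvd_sel // pgcd_dvd_pgcd // ltnW.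
apply: wp_seq; apply: wp_if => //; rewrite !evalE mR0 mG1 => test.
- have kj : keep A n i j (sel j.+1).1.
    by apply/eqP => eg; move: test; rewrite -eg subrr.
  rewrite /sel_step kj in sel_j.
  wp_next; rewrite mJ1 addrInE ag01 // m0A //.
    by apply: fits_le (A_fits j); lia.
  apply: wp_seq; apply: (@wp_gcd K s K_ge s_gt0 _ ((sel j.+1).1) (A j)) => //.
  (* The computed gcd is displayed as the first component of the updated pair, so that [sel_j] folds
     it into [(sel j).1]. *)
  move=> N2 m2 N2_le ag2; rewrite -[gcdn _ _]/((_, (sel j.+1).2.+1).1) -sel_j.
  move=> mR02 fV2 dV2.
  have mJ2 : m2 (addr Sc JJ) = j by rewrite ag2 // !updateE.
  have mC2 : m2 (addr Sc CNT) = (sel j.+1).2 by rewrite ag2 // !updateE.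
  wp_next; rewrite mR02.
    by apply: fits_le (fits_sel (ltnW jn)); lia.
  wp_next; rewrite ?mJ2 ?addrVE.
    by apply: fits_le fV2; lia.
  have cE : (sel j.+1).2%:Z + 1 = (sel j.+1).2.+1 by lia.
  wp_set; rewrite mC2 cE.
    apply: fits_le (fits_index (_ : ((sel j.+1).2.+1 <= n)%N)); first lia.
    by have := sel_le A i jn; lia.
  wp_set; rewrite ?mJ2 ?addrWE.
    by apply: fits_le (fits_sel (ltnW jn)); lia.
  split; first lia.
  split=> //; first exact: ltnW.
  + do 4!apply: agree_update => //.
    apply: agree_trans ag2 gcd_sel_keeps.
    by do 1!apply: agree_update => //.
  + by rewrite !updateE /= !ag2 // !updateE /= sel_j /=; split=> //; lia.
  + move=> l lj; rewrite !updateE /= (ltn_eqF lj) ag2 // !updateE /=.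
    exact: mW1.
  + move=> l /andP[jl ln]; rewrite !updateE /=.
    case: (eqVneq l j) => [->|lj] //=.
    by rewrite !ag2 // !updateE /=; apply: mV1; rewrite ln ltn_neqAle eq_sym lj jl.
- have /negPf kj : ~~ keep A n i j (sel j.+1).1.
    rewrite subr_le0 lez_nat in test.
    by rewrite negbK eqn_leq test dvdn_leq // gcdn_gt0 sel_pos.
  rewrite /sel_step kj in sel_j.
  wp_set; rewrite ?mJ1 ?addrVE.
    by rewrite /fits.
  wp_set; rewrite ?mJ1 ?mDC1 ?addrWE.
    by apply: fits_le fsel; lia.
  split; first lia.
  split=> //; first exact: ltnW.
  + by do 2!apply: agree_update => //.
  + by rewrite !updateE /= sel_j.
  + by move=> l lj; rewrite !updateE /= (ltn_eqF lj); apply: mW1.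
  + move=> l /andP[jl ln]; rewrite !updateE /=.
    case: (eqVneq l j) => [->|lj] //=; last first.
      by apply: mV1; rewrite ln ltn_neqAle eq_sym lj jl.
    rewrite sel_j; split=> //; split; rewrite ?eqxx //.
    by rewrite sel_j mul0r sub0r rpredN dvdzz.
Qed.

(** Per index, [16 * s + 10] for the prefix gcds and [32 * s + 20] for the selection, tests
    included; 8 counts six assignments and two final tests. *)
Definition sel_time := (s * (48 * s + 30) + 8)%N.

Definition sel_post m :=
  [/\ agree sel_keeps m0 m, m (addr Sc AI) = A i,
      m (addr Sc CNT) = (sel 0).2 &
      forall l, (l < n)%N ->
        m (addr Wa l) = (sel l).1 /\ cofactor_spec l (m (addr Va l))].

Lemma wp_sel : wp K sel_prog m0 (fun N m => (N <= sel_time)%N /\ sel_post m).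
Proof.
wp_next; rewrite m0I addrInE m0A //; first by apply: fits_le (A_fits i); lia.
wp_next; first by apply: fits_le (fits_nat (A_fits i)); lia.
wp_next; first by rewrite /fits.
wp_next; rewrite ?(addrWE 0 : addrW 0 = addr Wa 0).
  by apply: fits_le (fits_nat (A_fits i)); lia.
apply: wp_seq; apply: (@wp_while K K_gt0 pgcd_inv (16 * s + 9) n).
- exists 0%N; split=> //; first by rewrite subn0.
  + by do 4!apply: agree_update => //.
  + by case=> // _; rewrite !updateE.
- exact: wp_pgcd_loop.
move=> N1 k1 m1 N1_le [j [_ jn ag [mJ mAI mDC] mW]].
have mN : m1 (addr Sc NN) = n by rewrite ag.
rewrite !evalE mN mJ subr_le0 lez_nat => nj.
have jE : j = n by apply/eqP; rewrite eqn_leq jn.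
rewrite {j}jE in mJ mW {jn nj}.
wp_next; rewrite mN addrWE mW //; first by apply: fits_le (fits_pgcd _); lia.
wp_next; first by rewrite /fits.
apply: (@wp_while K K_gt0 sel_inv (32 * s + 19) n).
- split=> //.
  + by do 2!apply: agree_update => //.
  + by rewrite !updateE /= sel_n mJ mAI mDC.
  + by move=> l ln; rewrite !updateE /=; apply/mW/ltnW.
  + by move=> l /andP[/leq_ltn_trans nl /nl]; rewrite ltnn.
- exact: wp_sel_loop.
move=> N2 k2 m2 N2_le [_ ag2 [mJ2 mAI2 _ mC2 _] _ mV2].
rewrite evalE mJ2 => k2_le0.
have k20 : k2 = 0%N by lia.
rewrite k20 in mC2 mV2.
split; last by split.
rewrite /sel_time.
have : (n * (16 * s + 10) <= s * (16 * s + 10))%N by rewrite leq_mul2r n_le orbT.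
have : (n * (32 * s + 20) <= s * (32 * s + 20))%N by rewrite leq_mul2r n_le orbT.
lia.
Qed.

End Select.

(** * The solution program *)
Notation BEST := 15%N (only parsing).
Notation BI := 16%N (only parsing).
Notation CC := 17%N (only parsing).
Notation QI := 18%N (only parsing).
Notation AQ := 19%N (only parsing).
Notation ZZ := 20%N (only parsing).

Definition best_loop :=
  sel_prog;;
  PIfPos (ESub (eS BEST) (eS CNT)) (set_ BEST (eS CNT);; set_ BI (eS II)) PSkip;;
  set_ II (EAdd (eS II) (EConst 1)).

(** Cell 0 holds [n + 1], as [b] belongs to the input list. [BEST] starts above every possible
    count, so the first root tried replaces it. *)
Definition best_prog :=
  set_ NN (ESub (ECell (EConst (addr Inp 0))) (EConst 1));;
  set_ II (EConst 0);;
  set_ BEST (EAdd (eS NN) (EConst 1));;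
  set_ BI (EConst 0);;
  PWhilePos (ESub (eS NN) (eS II)) best_loop;;
  set_ II (eS BI).

(** The coordinate [x_j] overwrites the cell of [a_(j-1)], or of [b] if [j = 0], which is no longer
    read. *)
Definition solve_loop :=
  set_ TT (emod (EMul (EDiv (eS CC) (ECell (aW (eS JJ)))) (ECell (aV (eS JJ)))) (eS AI));;
  set_ CC (ESub (eS CC) (EMul (ECell (aIn (eS JJ))) (eS TT)));;
  PStore (aOut (eS JJ)) (eS TT);;
  set_ JJ (EAdd (eS JJ) (EConst 1)).

(** The selection is rerun because the arrays belong to the last root tried. For nonzero entries the
    guard of the search, [a_i a_q + 1 > 0], says that the signs agree. [AQ] is saved before the
    input is overwritten. *)
Definition solve_prog :=
  sel_prog;;
  set_ QI (EConst 0);;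
  PWhilePos (EAdd (EMul (eS AI) (ECell (aIn (eS QI)))) (EConst 1))
    (set_ QI (EAdd (eS QI) (EConst 1)));;
  set_ AQ (ECell (aIn (eS QI)));;
  set_ CC (ECell (EConst (addr Inp 1)));;
  set_ JJ (EConst 0);;
  PWhilePos (ESub (eS NN) (eS JJ)) solve_loop;;
  set_ ZZ (EDiv (eS CC) (eS AI));;
  PStore (aOut (eS QI))
    (ESub (ECell (aOut (eS QI))) (EMul (EMul (eS ZZ) (eS ZZ)) (EMul (eS AQ) (eS AI))));;
  PStore (aOut (eS II))
    (EAdd (ECell (aOut (eS II)))
       (EAdd (eS ZZ) (EMul (EMul (eS ZZ) (eS ZZ)) (EMul (eS AQ) (eS AQ)))));;
  PStore (EConst (addr Inp 0)) (eS NN).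

Lemma abszB_le (x y : int) : (`|(x - y)%R| <= `|x| + `|y|)%N.
Proof. lia. Qed.

(** For integers, [z + z * z >= 0] and [w * w >= 1]. *)
Lemma compensation_ge0 (z w : int) : w != 0 -> 0 <= z + z * z * (w * w).
Proof.
move=> w_neq0; have w_ge1 : 1 <= w * w by nia.
have z_ge0 : 0 <= z + z * z by nia.
apply: le_trans z_ge0 _; rewrite lerD2l ler_peMr // -expr2; exact: sqr_ge0.
Qed.

Section Main.
Variables (K s : nat).
Hypothesis K_ge : (10 * s <= K)%N.
Hypothesis s_gt0 : (0 < s)%N.

Ltac lia_K := clear - K_ge s_gt0; lia.

Let K_gt0 : (0 < K)%N. Proof. lia. Qed.

Variables (A : nat -> int) (n : nat).
Hypotheses (n_gt0 : (0 < n)%N) (n_le : (n <= s)%N).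
Hypothesis A_fits : forall k, fits s (A k).
Hypothesis A_neq0 : forall k, (k < n)%N -> A k != 0.

Let cnt k := (sel A n k 0).2.

Lemma dim_lt_exp2 : (n < 2 ^ s)%N.
Proof. by apply: leq_ltn_trans (ltn_expl s _). Qed.

(** * Choice of the root *)

Section Best.
Variable m0 : memory.
Hypothesis m0_size : m0 (addr Inp 0) = n.+1.
Hypothesis m0A : forall k, (k < n)%N -> m0 (addr Inp k.+2) = A k.

Definition is_inp c (k : nat) := if c is Inp then true else false.

Definition best_inv f m := exists ii bi best : nat,
  [/\ f = (n - ii)%N, (ii <= n)%N, agree is_inp m0 m,
      [/\ m (addr Sc NN) = n, m (addr Sc II) = ii, m (addr Sc BI) = bi &
          m (addr Sc BEST) = best] &
      [/\ (bi < n)%N, best = cnt bi \/ best = n.+1 &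
          forall k, (k < ii)%N -> (best <= cnt k)%N]].

Lemma cnt_le k : (cnt k <= n)%N.
Proof. by have := sel_le A k (leq0n n); rewrite subn0. Qed.

Lemma wp_best_loop k m : best_inv k m -> 0 < eval m (ESub (eS NN) (eS II)) ->
  exists2 k', k = k'.+1 &
    wp K best_loop m (fun N m' => (N <= sel_time s + 4)%N /\ best_inv k' m').
Proof.
move=> [ii [bi [best [kE ii_le ag [mN mI mBI mB] [bi_lt best_eq best_le]]]]].
rewrite !evalE mN mI subr_gt0 ltz_nat => ii_lt.
exists (n - ii.+1)%N; first lia.
apply: wp_seq; apply: wp_mono (wp_sel K_ge s_gt0 ii_lt n_le A_fits A_neq0 mN mI _) _.
  by move=> l ln; rewrite ag // m0A.
move=> N1 m1 [N1_le [ag1 _ mC1 _]].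
have mI1 : m1 (addr Sc II) = ii by rewrite ag1.
have ag01 : agree is_inp m0 m1 by apply: agree_trans ag1 _ => // -[].
have iE : ii%:Z + 1 = ii.+1 by lia.
have fC : fits K (cnt ii).
  apply: fits_le (fits_nat (_ : (_ <= 2 ^ s)%N)); first lia.
  by apply: leq_trans (cnt_le ii) (ltnW dim_lt_exp2).
have fI l : (l <= n)%N -> fits K l.
  move=> ln; apply: fits_le (fits_nat (_ : (_ <= 2 ^ s)%N)); first lia.
  by apply: leq_trans ln (ltnW dim_lt_exp2).
apply: wp_seq; apply: wp_if => //; rewrite !evalE mC1 !ag1 // mB => test.
- wp_next; rewrite mC1 //.
  wp_set; rewrite mI1; first by apply: fI; lia.
  wp_set; rewrite mI1 iE; first exact: fI.
  split; first lia.
  exists ii.+1, ii, (cnt ii); split=> //.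
  + by do 3!apply: agree_update => //.
  + by split; rewrite !updateE //= ag1.
  split=> //; first by left.
  move=> l; rewrite ltnS leq_eqVlt => /orP[/eqP->//|/best_le].
  by apply: leq_trans; move: test; rewrite -/(cnt _); lia.
- apply: wp_skip => //.
  wp_set; rewrite mI1 iE; first exact: fI.
  split; first lia.
  exists ii.+1, bi, best; split=> //.
  + by do 1!apply: agree_update => //.
  + by split; rewrite !updateE //= ag1.
  split=> // l; rewrite ltnS leq_eqVlt => /orP[/eqP->|/best_le//].
  by move: test; rewrite -/(cnt _); lia.
Qed.

Definition best_post m :=
  agree is_inp m0 m /\ m (addr Sc NN) = n /\
  exists i : nat, [/\ m (addr Sc II) = i, (i < n)%N &
    forall k, (k < n)%N -> (cnt i <= cnt k)%N].

Definition best_time := (s * (sel_time s + 5) + 6)%N.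

Lemma wp_best : wp K best_prog m0 (fun N m => (N <= best_time)%N /\ best_post m).
Proof.
have nE : n.+1%:Z - 1 = n by lia.
have nE' : n%:Z + 1 = n.+1 by lia.
have f0 : fits K 0 by [].
wp_next; rewrite m0_size nE.
  by apply: fits_le (fits_nat (ltnW dim_lt_exp2)); lia.
wp_next => //.
wp_next; rewrite nE'.
  by apply: fits_le (fits_nat dim_lt_exp2); lia.
wp_next => //.
apply: wp_seq; apply: (@wp_while K K_gt0 best_inv (sel_time s + 4) n).
- exists 0%N, 0%N, n.+1; split=> //; first by rewrite subn0.
  + by do 4!apply: agree_update => //.
  + by split=> //; right.
- exact: wp_best_loop.
move=> N k m N_le [ii [bi [best [_ ii_le ag [mN mI mBI mB] [bi_lt best_eq best_le]]]]].
rewrite !evalE mN mI subr_le0 lez_nat => n_ii.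
have iiE : ii = n by apply/eqP; rewrite eqn_leq ii_le.
wp_set; rewrite mBI.
  apply: fits_le (fits_nat (ltnW (ltn_trans bi_lt dim_lt_exp2))); lia.
split.
  have : (n * (sel_time s + 5) <= s * (sel_time s + 5))%N by rewrite leq_mul2r n_le orbT.
  rewrite /best_time; lia.
split; first by apply: agree_update.
split; first by rewrite updateE.
exists bi; rewrite updateE; split=> // l ln.
case: best_eq best_le => -> best_le; rewrite ?iiE in best_le; first exact: best_le.
(* The initial value [n.+1] cannot survive: the count of the root 0 is at most [n]. *)
by have := best_le _ n_gt0; have := cnt_le 0; lia.
Qed.
End Best.

(** * Construction of a solution from a chosen root *)

Section Solve.
Variables (i q0 : nat) (b : int).
Hypotheses (i_lt : (i < n)%N) (q0_lt : (q0 < n)%N) (opp_sign : A i * A q0 < 0).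
Hypothesis b_fits : fits s b.
Hypothesis g_dvd_b : (pgcd A i n %| b)%Z.

Variable m0 : memory.
Hypothesis m0N : m0 (addr Sc NN) = n.
Hypothesis m0I : m0 (addr Sc II) = i.
Hypothesis m0b : m0 (addr Inp 1) = b.
Hypothesis m0A : forall k, (k < n)%N -> m0 (addr Inp k.+2) = A k.

Local Notation sel := (sel A n i).

Definition residual (m : memory) j : int := b - \sum_(k < j) A k * m (addr Inp k.+1).

(** Cells 1 to [j] already hold coordinates, while those from [j + 2] on still hold entries of [a].
    The size bound counts [b] and [j] products, each at most [2 ^ (2 * s)]. *)
Definition solve_inv (q f : nat) (m : memory) := exists j : nat,
  [/\ f = (n - j)%N, (j <= n)%N,
      [/\ m (addr Sc NN) = n, m (addr Sc II) = i, m (addr Sc AI) = A i,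
          m (addr Sc QI) = q & m (addr Sc AQ) = A q],
      [/\ m (addr Sc JJ) = j, m (addr Sc CC) = residual m j,
          ((sel j).1 %| residual m j)%Z & (`|residual m j| <= j.+1 * 2 ^ (2 * s))%N] &
      [/\ forall k, (j <= k < n)%N -> m (addr Inp k.+2) = A k,
          forall k, (k < n)%N -> m (addr Wa k) = (sel k).1 /\
                                 cofactor_spec s A n i k (m (addr Va k)) &
          forall k, (k < j)%N -> [/\ 0 <= m (addr Inp k.+1), fits s (m (addr Inp k.+1)) &
            m (addr Inp k.+1) != 0 -> keep A n i k (sel k.+1).1]]].

Lemma residual_update m j v : residual (update m (addr Inp j.+1) v) j.+1 =
  residual m j - A j * v.
Proof.
rewrite /residual big_ord_recr /= updateE eqxx opprD addrA; congr (_ - _ - _).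
by apply: eq_bigr => k _; rewrite updateE /= eqSS ltn_eqF.
Qed.

Lemma residual_Sc m j k v : residual (update m (addr Sc k) v) j = residual m j.
Proof. by congr (_ - _); apply: eq_bigr => l _; rewrite updateE. Qed.

Lemma residual_fits m j : (j <= n)%N -> (`|residual m j| <= j.+1 * 2 ^ (2 * s))%N ->
  fits (3 * s) (residual m j).
Proof.
move=> jn /leq_trans; apply; rewrite -[(3 * s)%N]/(s + 2 * s)%N expnD leq_mul2r.
by rewrite (leq_ltn_trans jn dim_lt_exp2) orbT.
Qed.

Lemma wp_solve_loop q k m : solve_inv q k m -> 0 < eval m (ESub (eS NN) (eS JJ)) ->
  exists2 k', k = k'.+1 &
    wp K solve_loop m (fun N m' => (N <= 4)%N /\ solve_inv q k' m').
Proof.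
move=> [j [kE jn [mN mI mAI mQ mAQ] [mJ mC dC leC] [mA mWV mX]]].
rewrite !evalE mN mJ subr_gt0 ltz_nat => j_lt.
exists (n - j.+1)%N; first lia.
have jE : j%:Z + 1 = j.+1 by lia.
have [mW [fV dV keepV]] := mWV j j_lt.
have Ai_neq0 : A i != 0 by rewrite A_neq0.
have [c cE] : {c | c = residual m j} by eexists.
rewrite -cE in mC dC leC.
have [t tE] : {t | t = ((c %/ (sel j).1)%Z * m (addr Va j) %% A i)%Z} by eexists.
have t_ge0 : 0 <= t by rewrite tE modz_ge0.
have t_lt : (`|t| < `|A i|)%N by rewrite -ltz_nat !abszE (ger0_norm t_ge0) tE ltz_mod.
have ft : fits s t by apply: leq_trans (ltnW t_lt) (A_fits i).
have fc : fits (3 * s) c by rewrite cE; apply: residual_fits; rewrite -?cE.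
have leC' : (`|(c - A j * t)%R| <= j.+2 * 2 ^ (2 * s))%N.
  have : (`|(A j * t)%R| <= 2 ^ (2 * s))%N.
    by rewrite abszM mul2n -addnn expnD; apply: leq_mul (A_fits j) ft.
  move=> fAt; apply: leq_trans (abszB_le _ _) _.
  by rewrite addnC [(j.+2 * _)%N]mulSn leq_add.
wp_next; rewrite mC mJ addrWE addrVE mW mAI -tE.
  by apply: fits_le ft; lia_K.
wp_next; rewrite mC mJ addrInE updateE /= mA ?leqnn //.
  by apply: fits_le (fitsB fc (fitsM (A_fits j) ft)); lia_K.
wp_next; rewrite ?mJ ?addrOutE.
  by apply: fits_le ft; lia_K.
wp_set; rewrite mJ jE.
  apply: fits_le (fits_nat (leq_trans j_lt (ltnW dim_lt_exp2))); lia_K.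
split=> //; exists j.+1.
have resE : residual (update (update (update (update m (addr Sc TT) t) (addr Sc CC)
    (c - A j * t)) (addr Inp j.+1) t) (addr Sc JJ) j.+1) j.+1 = c - A j * t.
  by rewrite residual_Sc residual_update !residual_Sc cE.
split=> //.
- split; rewrite ?resE //.
  have /dvdzP[u cuE] := dC.
  have sel_pos := sel_gt0 Ai_neq0 jn.
  (* With [c = u * (sel j).1], the first term is a multiple of [(sel j.+1).1] by the cofactor
     congruence, the second because that gcd divides [A i]. *)
  have -> : c - A j * t = - (u * (m (addr Va j) * A j - (sel j).1%:Z)) +
      A j * ((c %/ (sel j).1)%Z * m (addr Va j) %/ A i)%Z * A i.
    rewrite tE /modz cuE mulzK; last by rewrite eqz_nat -lt0n.
    ring.
  rewrite rpredD ?rpredN ?dvdz_mull //.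
  exact: sel_dvdl.
- split.
  + move=> l /andP[jl ln]; rewrite !updateE /= eqSS (gtn_eqF (leqW jl)).
    by rewrite mA // ln ltnW.
  + by move=> l ln; rewrite !updateE /=; apply: mWV.
  + move=> l; rewrite ltnS leq_eqVlt => /orP[/eqP->|lj]; last first.
      by rewrite !updateE /= eqSS ltn_eqF //; apply: mX.
    rewrite !updateE /= eqxx; split=> // t_neq0; apply: keepV.
    by apply: contraNneq t_neq0 => V0; rewrite tE V0 mulr0 mod0z.
Qed.

Definition solve_time := (sel_time s + 7 * s + 11)%N.

Definition solve_post (m : memory) := exists2 q, (q < n)%N &
  [/\ m (addr Inp 0) = n, \sum_(k < n) A k * m (addr Inp k.+1) = b,
      forall k, (k < n)%N -> 0 <= m (addr Inp k.+1) &
      forall k, (k < n)%N -> m (addr Inp k.+1) != 0 ->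
        [|| keep A n i k (sel k.+1).1, k == i | k == q]].

Definition find_keeps c k :=
  match c with Sc => (k != QI)%N | _ => true end.

(** The search stops at the first index of opposite sign; [q0] only bounds it. *)
Definition find_inv m1 f (m : memory) := exists k : nat,
  [/\ f = (q0 - k)%N, (k <= q0)%N, m (addr Sc QI) = k & agree find_keeps m1 m].

Lemma wp_solve : wp K solve_prog m0 (fun N m => (N <= solve_time)%N /\ solve_post m).
Proof.
have Ai_neq0 : A i != 0 by rewrite A_neq0.
apply: wp_seq; apply: wp_mono (wp_sel K_ge s_gt0 i_lt n_le A_fits A_neq0 m0N m0I m0A) _.
move=> N1 m1 [N1_le [ag1 mAI1 _ mWV1]].
have fn l : (l <= n)%N -> fits K l.
  move=> ln; apply: fits_le (fits_nat (leq_trans ln (ltnW dim_lt_exp2))); lia_K.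
wp_next; first by rewrite /fits.
apply: wp_seq; apply: (@wp_while K K_gt0 (find_inv m1) 1 q0).
- exists 0%N; split=> //; first by rewrite subn0.
  by apply: agree_update.
- move=> f m [k [fE kq mQ ag]].
  rewrite !evalE mQ addrInE !ag // mAI1 ag1 // m0A ?(leq_ltn_trans kq) // => test.
  have kq' : (k < q0)%N.
    rewrite ltn_neqAle kq andbT; apply/eqP => kE; move: test opp_sign; rewrite kE; lia.
  exists (q0 - k.+1)%N; first lia.
  have kE : k%:Z + 1 = k.+1 by lia.
  wp_set; rewrite mQ kE; first by apply: fn; lia.
  split=> //; exists k.+1; split=> //.
  by apply: agree_update.
move=> N2 f m2 N2_le [q [_ q_le mQ2 ag2]].
have q_lt : (q < n)%N by apply: leq_ltn_trans q_le q0_lt.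
rewrite !evalE mQ2 addrInE !ag2 // mAI1 ag1 // m0A // => test.
have {test} qi : A i * A q < 0 by lia.
wp_next; rewrite mQ2 addrInE ag2 // ag1 // m0A //.
  by apply: fits_le (A_fits q); lia_K.
wp_next; rewrite ag2 // ag1 // m0b.
  by apply: fits_le b_fits; lia_K.
wp_next; first by rewrite /fits.
apply: wp_seq; apply: (@wp_while K K_gt0 (solve_inv q) 4 n).
- have res0 m : residual m 0 = b by rewrite /residual big_ord0 subr0.
  exists 0%N; split=> //; first by rewrite subn0.
  + split; rewrite !updateE //= ag2 // ag1 //.
  + split; rewrite ?res0 ?sel0 //.
    rewrite mul1n; apply: leq_trans b_fits _; rewrite leq_exp2l //; lia.
  + split=> //.
      by move=> l ln; rewrite !updateE /= ag2 // ag1 // m0A.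
    by move=> l ln; rewrite !updateE /= !ag2 //; apply: mWV1.
- exact: wp_solve_loop.
move=> N3 k3 m3 N3_le [j [_ jn [mN mI mAI mQ mAQ] [mJ mC dC leC] [_ _ mX]]].
rewrite !evalE mN mJ subr_le0 lez_nat => nj.
have jE : j = n by apply/eqP; rewrite eqn_leq jn.
subst j.
have fc := residual_fits (leqnn n) leC.
have [c cE] : {c | c = residual m3 n} by eexists.
rewrite -cE in mC dC leC fc.
have [z zE] : {z | z = (c %/ A i)%Z} by eexists.
have fz : fits (3 * s) z by rewrite zE; apply: fits_div.
(* At [j = n] the selected gcd is the absolute value of [A i] itself, so the division is exact. *)
have czE : c = z * A i.
  by rewrite zE divzK //; move: dC; rewrite sel_n.
have qi_neq : q != i by apply: contraTneq qi => ->; rewrite -leNgt -expr2 sqr_ge0.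
have [[xq_ge0 fxq _] [xi_ge0 fxi _]] := (mX q q_lt, mX i i_lt).
wp_next; rewrite mC mAI -zE; first by apply: fits_le fz; lia_K.
wp_next; rewrite ?mQ ?mAQ ?mAI ?addrOutE ?updateE /=.
  have fqi := fitsM (A_fits q) (A_fits i).
  by apply: fits_le (fitsB fxq (fitsM (fitsM fz fz) fqi)); lia_K.
wp_next; rewrite ?mI ?mAQ ?addrOutE ?updateE /= ?eqSS eq_sym ?(negPf qi_neq).
  have fqq := fitsM (A_fits q) (A_fits q).
  (* This bound dictates the constant 10: [z] has [3 * s] bits, the product [8 * s], and two
     additions give [8 * s + 2 <= 10 * s]. *)
  by apply: fits_le (fitsD fxi (fitsD fz (fitsM (fitsM fz fz) fqq))); lia_K.
wp_set; rewrite mN; first exact: fn.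
split.
  move: N1_le N2_le N3_le (ltnW q0_lt) n_le; rewrite /solve_time; clear; lia.
exists q => //.
set m4 := update _ _ _.
have xE k : m4 (addr Inp k.+1) = m3 (addr Inp k.+1) +
    (if k == i then z + z * z * (A q * A q) else 0) -
    (if k == q then z * z * (A q * A i) else 0).
  rewrite /m4 !updateE /= !eqSS; case: eqP => [->|_].
    by rewrite eq_sym (negPf qi_neq) subr0.
  by case: eqP => [->|_]; rewrite ?addr0 ?subr0.
split.
- by rewrite /m4 updateE.
(* The terms in [z * z] cancel between [i] and [q]; what remains, [z * A i], is the final residual
   [c]. *)
- transitivity (\sum_(k < n) (A k * m3 (addr Inp k.+1) +
    ((if k == Ordinal i_lt then A k * (z + z * z * (A q * A q)) else 0) -
     (if k == Ordinal q_lt then A k * (z * z * (A q * A i)) else 0)))).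
    apply: eq_bigr => k _; rewrite xE -!val_eqE /=.
    by case: ifP; case: ifP => _ _; ring.
  rewrite big_split sumrB /= -!big_mkcond !big_pred1_eq /=.
  have -> : \sum_(k < n) A k * m3 (addr Inp k.+1) = b - c.
    by rewrite cE /residual opprB addrC subrK.
  rewrite czE; ring.
- move=> k kn; rewrite xE; have [x_ge0 _ _] := mX k kn.
  have h1 := compensation_ge0 z (A_neq0 q_lt).
  have h2 : z * z * (A q * A i) <= 0.
    by rewrite mulr_ge0_le0 -?expr2 ?sqr_ge0 // mulrC ltW.
  by move: x_ge0 h1 h2; case: ifP => _; case: ifP => _; clear; lia.
- move=> k kn; rewrite xE; have [_ _ x_keep] := mX k kn.
  case: (k == i); first by rewrite orbT.
  case: (k == q); first by rewrite !orbT.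
  by rewrite addr0 subr0 !orbF.
Qed.
End Solve.
End Main.

Definition knapsack_prog := best_prog;; solve_prog.

(** Number of steps times the cost of one step, [ucost] with [K = 10 * s], where [P] is the fixed
    program size. *)
Lemma time_poly (P : nat) : exists q : {poly nat}, forall s,
  q.[s] = ((best_time s + solve_time s) * (P * (10 * s * P + 2)))%N.
Proof.
pose T : {poly nat} := 'X * (48%N%:P * 'X + 30%N%:P) + 8%N%:P.
exists (('X * (T + 5%N%:P) + 6%N%:P + (T + 7%N%:P * 'X + 11%N%:P)) *
  (P%:P * (10%N%:P * 'X * P%:P + 2%N%:P))) => s.
by rewrite !hornerE.
Qed.

Section Knapsack.
Variables (n : nat) (a : 'cV[int]_n) (b : int).
Hypothesis a_mixed : nonzero_mixed_sign a.
Hypothesis feasible : exists x, knapsack_sol a b x.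

Let A k := (entries a)`_k.
Let s := insize (b :: entries a).

Lemma size_entries (x : 'cV[int]_n) : size (entries x) = n.
Proof. by rewrite size_map -cardE card_ord. Qed.

Lemma nth_entries (x : 'cV[int]_n) (k : 'I_n) : (entries x)`_k = x k 0.
Proof. by rewrite (nth_map k) ?nth_ord_enum // -cardE card_ord. Qed.

Lemma entry_neq0 k : (k < n)%N -> A k != 0.
Proof.
by move=> kn; rewrite /A (nth_entries a (Ordinal kn)); case: a_mixed.
Qed.

Lemma dim_gt0 : (0 < n)%N.
Proof. by case: a_mixed => _ [[k kn] _] _; apply: leq_ltn_trans kn. Qed.

Lemma insize_ge_size (r : seq int) : (size r <= insize r)%N.
Proof.
rewrite /insize -sum1_size; apply: leq_sum => z _; exact: ltn0Sn.
Qed.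

Lemma fits_insize (r : seq int) z : z \in r -> fits (insize r) z.
Proof.
move=> zr; apply: fits_le (fits_bitsize z).
by rewrite /insize (big_rem z zr) leq_addr.
Qed.

Lemma dim_lt_insize : (n < s)%N.
Proof. by rewrite -[n](size_entries a); apply: (insize_ge_size (b :: _)). Qed.

Lemma fits_b : fits s b.
Proof. by apply: fits_insize; apply: mem_head. Qed.

Lemma fits_entry k : fits s (A k).
Proof.
rewrite /A; case: (ltnP k n) => kn; last first.
  by rewrite nth_default ?size_entries.
apply: fits_insize; rewrite inE mem_nth ?orbT // size_entries //.
Qed.

Lemma load_bounded : bounded (10 * s) (load (b :: entries a)).
Proof.
move=> [[|k]|k] //=.
- rewrite size_entries; apply: fits_nat; apply: leq_trans dim_lt_insize _.
  apply: leq_trans (ltnW (ltn_expl s (isT : 1 < 2)%N)) _.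
  by rewrite leq_exp2l // leq_pmull.
- apply: (@fits_le s); first by rewrite leq_pmull.
  case: k => [|k]; [exact: fits_b|exact: fits_entry].
Qed.

Lemma pgcd_gcdv i : (i < n)%N -> pgcd A i n = gcdv a.
Proof.
move=> i_lt; apply/eqP; rewrite eqn_dvd; apply/andP; split.
- apply/dvdn_biggcdP => k _; rewrite -nth_entries.
  by apply: pgcd_dvdr; apply: ltn_ord.
- have gA k : (k < n)%N -> (gcdv a %| `|A k|%N)%N.
    move=> kn; rewrite /A (nth_entries a (Ordinal kn)).
    by apply: (biggcdn_inf (Ordinal kn)).
  by apply: dvdn_pgcd; [exact: gA|move=> l; exact: gA].
Qed.

(** Feasibility enters through this divisibility, which starts the invariant of the residual. *)
Lemma gcdv_dvd_b : (gcdv a %| b)%Z.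
Proof.
case: feasible => x [/matrixP/(_ 0 0)]; rewrite !mxE eqxx mulr1n => <- _.
apply: rpred_sum => k _; apply: dvdz_mulr; rewrite mxE dvdzE.
exact: (biggcdn_inf k).
Qed.

Lemma knapsack_prog_correct (q : {poly nat}) :
  (forall s, q.[s] = ((best_time s + solve_time s) *
     (psize knapsack_prog * (10 * s * psize knapsack_prog + 2)))%N) ->
  exists x, sparse_sol a b x /\
    computes_in knapsack_prog (b :: entries a) q.[s] (entries x).
Proof.
move=> qE; have s_gt0 : (0 < s)%N by apply: leq_ltn_trans dim_lt_insize.
have K_gt0 : (0 < 10 * s)%N by rewrite muln_gt0.
have n_le := ltnW dim_lt_insize.
pose m0 := load (b :: entries a).
have m0_size : m0 (addr Inp 0) = n.+1 by rewrite /m0 /= size_entries.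
have m0A k : (k < n)%N -> m0 (addr Inp k.+2) = A k by [].
have: wp (10 * s) knapsack_prog m0 (fun N m => (N <= best_time s + solve_time s)%N /\
  exists2 i, (i < n)%N /\ (forall k, (k < n)%N -> ((sel A n i 0).2 <= (sel A n k 0).2)%N)
  & solve_post A n i b m).
  apply: wp_seq.
  apply: wp_mono (wp_best (leqnn _) s_gt0 dim_gt0 n_le fits_entry entry_neq0
    m0_size m0A) _.
  move=> N1 m1 [N1_le [ag [mN [i [mI i_lt i_min]]]]].
  have [q0 q0_lt q0_sign] : exists2 q0, (q0 < n)%N & A i * A q0 < 0.
    case: a_mixed => _ [kp]; rewrite -nth_entries -/(A kp) => kp_gt0.
    case=> kn; rewrite -nth_entries -/(A kn) => kn_lt0.
    have := entry_neq0 i_lt; rewrite neq_lt => /orP[Ai|Ai].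
      by exists kp; rewrite // nmulr_rlt0.
    by exists kn; rewrite // pmulr_rlt0.
  have g_dvd : (pgcd A i n %| b)%Z by rewrite pgcd_gcdv // gcdv_dvd_b.
  have m1b : m1 (addr Inp 1) = b by rewrite ag.
  have m1A k : (k < n)%N -> m1 (addr Inp k.+2) = A k by move=> kn; rewrite ag // m0A.
  apply: wp_mono (wp_solve (leqnn _) s_gt0 dim_gt0 n_le fits_entry entry_neq0
    i_lt q0_lt q0_sign fits_b g_dvd mN mI m1b m1A) _.
  move=> N2 m2 [N2_le post]; split; first exact: leq_add.
  by exists i.
move=> /(_ load_bounded) [N [t [m [ex tN _ [N_le [i [i_lt i_min]]]]]]].
move=> [qi qi_lt [mn sum_b x_ge0 supp]].
(* The solution is read off the final memory, so existence and computability are proved together. *)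
pose x : 'cV[int]_n := \col_k m (addr Inp k.+1).
exists x; split; last first.
  exists t, m; split=> //.
    by rewrite qE; apply: leq_trans tN _; rewrite leq_mul.
  rewrite size_entries => -[|k] k_le; first by rewrite [LHS]mn /= size_entries.
  by rewrite /= (nth_entries x (Ordinal k_le)) mxE.
split; first split.
- apply/matrixP => k l; rewrite !ord1 !mxE eqxx mulr1n -sum_b.
  by apply: eq_bigr => j _; rewrite !mxE -nth_entries.
- by move=> k; rewrite mxE x_ge0.
have [k0 min_eq] := minI_attained (fun k => omega (`|a k ord0| %/ gcdv a)) dim_gt0.
rewrite min_eq.
(* The chosen root [i] need not attain the minimum of [omega], but its count is at most that of
   [k0], which does. *)
have cnt_le : ((sel A n i 0).2 <= omega (`|a k0 ord0| %/ gcdv a))%N.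
  apply: leq_trans (i_min k0 (ltn_ord k0)) _.
  have := sel_omega (entry_neq0 (ltn_ord k0)) (leq0n n).
  by rewrite pgcd_gcdv // /A nth_entries; apply: leq_trans; apply: leq_addr.
apply: (@leq_trans (2 + (sel A n i 0).2)); last by rewrite leq_add2l.
rewrite sel_count // big_mkord.
pose S := [set k : 'I_n | keep A n i k (sel A n i k.+1).1].
have -> : (\sum_(k < n) keep A n i k (sel A n i k.+1).1)%N = #|S|.
  by rewrite -sum1_card [RHS]big_mkcond /=; apply: eq_bigr => k _; rewrite inE;
    case: (keep _ _ _ _ _).
have sub : [set k | x k 0 != 0] \subset S :|: [set Ordinal i_lt; Ordinal qi_lt].
  apply/subsetP => k; rewrite !inE mxE => /(supp _ (ltn_ord k)).
  by rewrite -!val_eqE.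
apply: leq_trans (subset_leq_card sub) _.
apply: leq_trans (leq_card_setU _ _) _; rewrite addnC leq_add2r cards2.
by case: (_ != _).
Qed.

End Knapsack.

Theorem corollary4 :
  (forall (n : nat) (a : 'cV[int]_n) (b : int),
     nonzero_mixed_sign a -> (exists x, knapsack_sol a b x) ->
     exists x, sparse_sol a b x) /\
  (exists (p : prog) (q : {poly nat}),
     forall (n : nat) (a : 'cV[int]_n) (b : int),
     nonzero_mixed_sign a -> (exists x, knapsack_sol a b x) ->
     exists x, sparse_sol a b x /\
       computes_in p (b :: entries a) q.[insize (b :: entries a)] (entries x)).
Proof.
have [q qE] := time_poly (psize knapsack_prog).
have correct n a b a_mixed feasible := @knapsack_prog_correct n a b a_mixed feasible q qE.
split; last by exists knapsack_prog, q.
move=> n a b a_mixed feasible.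
by have [x [x_sol _]] := correct n a b a_mixed feasible; exists x.
Qed.
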